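(* Let $R$ be a commutative ring with nonzero identity, let $M_1$ and $M_2$ be two nonzero cyclic $R$-modules, and let $M=M_1\oplus M_2$. Then $M$ is a pseudo simple $R$-module if and only if $M_1$ and $M_2$ are simple modules and one of the following conditions holds: (i) $\operatorname{ann}(M_1)\neq\operatorname{ann}(M_2)$ are maximal ideals of $R$, and $(m_1,m_2)$ is a generator of $M$ (i.e. $R(m_1,m_2)=M$) for all nonzero $m_1\in M_1$ and nonzero $m_2\in M_2$. (ii) $\operatorname{ann}(M_1)=\operatorname{ann}(M_2)$ is a maximal ideal of $R$.
   Context: For a commutative ring $R$ with nonzero identity (not necessarily a domain), an $R$-module $M$ is called pseudo simple if the submodule $Rm$ is simple for every $0\neq m\in M$ with $Rm\neq M$. $\operatorname{ann}(M)=\{r\in R: rM=0\}$. *)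

(* Defs.v *)
From HB Require Import structures.
From mathcomp Require Import all_boot all_order all_algebra.
From mathcomp Require Import all_classical.

Set Implicit Arguments.
Unset Strict Implicit.
Unset Printing Implicit Defensive.

Import GRing.Theory.

Local Open Scope ring_scope.
Local Open Scope classical_set_scope.

(* Submodules and ideals are Prop-valued sets, so that arbitrary ones are
   covered, not only those with a decidable membership test. *)
Section Modules.
Variables (R : comNzRingType) (M : lmodType R).

Definition is_submodule (N : set M) : Prop := submod_closed (mem N).

Definition span1 (m : M) : set M := range (fun r : R => r *: m).

Definition simple_submodule (N : set M) : Prop :=
  [/\ is_submodule N, N <> [set 0] &
      forall K : set M, is_submodule K -> K `<=` N -> K = [set 0] \/ K = N].

End Modules.

Definition nonzero_module (R : comNzRingType) (M : lmodType R) : Prop :=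
  [set: M] <> [set 0].

Definition simple_module (R : comNzRingType) (M : lmodType R) : Prop :=
  simple_submodule [set: M].

Definition cyclic_module (R : comNzRingType) (M : lmodType R) : Prop :=
  exists m : M, span1 m = [set: M].

Definition pseudo_simple (R : comNzRingType) (M : lmodType R) : Prop :=
  forall m : M, m != 0 -> span1 m <> [set: M] -> simple_submodule (span1 m).

Definition ann (R : comNzRingType) (M : lmodType R) : set R :=
  [set r | forall m : M, r *: m = 0].

(* [idealr_closed] requires [1] not to be a member, hence describes the proper
   ideals. *)
Definition maximal_ideal (R : comNzRingType) (I : set R) : Prop :=
  idealr_closed (mem I) /\
  forall J : set R, idealr_closed (mem J) -> I `<=` J -> J = I.

(* Main.v *)
(** A cyclic module [R m] is [R / ann m], so its simplicity depends only on the
    annihilator of [m]. This transfers simplicity between [m1] and [(m1, 0)],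
    and from [m1] to [(m1, m2)] when [m1] and [m2] have the same annihilator.
    When the maximal ideals [ann M1] and [ann M2] differ, some [r] annihilates
    [M1] but not [M2]; then [r (m1, m2) = (0, r m2)] generates [0 * M2], whence
    [(m1, m2)] generates everything. *)

Require Import Defs.
From mathcomp Require Import all_boot all_order all_algebra.
From mathcomp Require Import all_classical.

Import GRing.Theory.

Local Open Scope ring_scope.
Local Open Scope classical_set_scope.

Lemma submoduleP (R : comNzRingType) (M : lmodType R) (N : set M) :
  is_submodule N <-> N 0 /\ forall a u v, N u -> N v -> N (a *: u + v).
Proof.
split=> [[N0 NL]|[N0 NL]].
  split=> [|a u v Nu Nv]; first exact/set_mem.
  by apply/set_mem/NL; exact/mem_set.
split=> [|a u v Nu Nv]; first exact/mem_set.
by apply/mem_set/NL; exact/set_mem.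
Qed.

Lemma idealr_closedP (R : comNzRingType) (I : set R) :
  idealr_closed (mem I) <->
  [/\ I 0, ~ I 1 & forall a u v, I u -> I v -> I (a * u + v)].
Proof.
split=> [[I0 I1 IL]|[I0 I1 IL]].
  split=> [||a u v Iu Iv]; first exact/set_mem.
    by move=> /mem_set Ie; move/negP: I1; apply.
  by apply/set_mem/IL; exact/mem_set.
split=> [||a u v Iu Iv]; first exact/mem_set.
  by apply/negP => /set_mem.
by apply/mem_set/IL; exact/set_mem.
Qed.

Lemma span1_submodule (R : comNzRingType) (M : lmodType R) (m : M) :
  is_submodule (span1 m).
Proof.
apply/submoduleP; split; first by exists 0 => //; rewrite scale0r.
move=> a _ _ [r _ <-] [s _ <-]; exists (a * r + s) => //.
by rewrite scalerDl scalerA.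
Qed.

Lemma submodule_span1 (R : comNzRingType) (M : lmodType R) (N : set M) (m : M) :
  is_submodule N -> N m -> span1 m `<=` N.
Proof.
move=> /submoduleP[N0 NL] Nm _ [r _ <-].
by rewrite -[_ *: _]addr0; exact: NL.
Qed.

Lemma span1_id (R : comNzRingType) (M : lmodType R) (m : M) : span1 m m.
Proof. by exists 1 => //; rewrite scale1r. Qed.

(** This trades the quantification over submodules for one over scalars: a nonzero submodule of
    [span1 m] contains some nonzero [c *: m], and recovering [m] from it forces the submodule to be
    everything. *)
Lemma simple_span1P (R : comNzRingType) (M : lmodType R) (m : M) :
  simple_submodule (span1 m) <->
  m != 0 /\ forall c, c *: m != 0 -> exists d, (d * c) *: m = m.
Proof.
split=> [[_ m_nz simple_m]|[m_nz inv_m]].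
  split.
    apply/eqP => m0; apply: m_nz; apply/seteqP; split=> [_ [r _ <-]|_ ->].
      by rewrite m0 scaler0.
    by rewrite m0; exact: span1_id.
  move=> c cm_nz; have cm_m : span1 (c *: m) `<=` span1 m.
    by apply: submodule_span1; [exact: span1_submodule|exists c].
  have [cm0|cmE] := simple_m _ (span1_submodule _ _ (c *: m)) cm_m.
    have : span1 (c *: m) (c *: m) by exact: span1_id.
    by rewrite cm0 => /= cm0'; rewrite cm0' eqxx in cm_nz.
  have : span1 (c *: m) m by rewrite cmE; exact: span1_id.
  by move=> [d _ dcm]; exists d; rewrite -scalerA.
split; first exact: span1_submodule.
  move=> m0; have : span1 m m by exact: span1_id.
  by rewrite m0 => /= m0'; rewrite m0' eqxx in m_nz.
move=> K subK Km; have [[k [Kk k_nz]]|K0] := pselect (exists k, K k /\ k != 0).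
  right; apply/seteqP; split=> //; apply: submodule_span1 => //.
  have [c _ cmk] := Km _ Kk; have [|d dcm] := inv_m c; first by rewrite cmk.
  rewrite -dcm -scalerA cmk; apply: submodule_span1 Kk _ _ => //.
  by exists d.
left; apply/seteqP; split=> [k Kk|_ ->]; last by have /submoduleP[] := subK.
by apply: contrapT => /eqP k_nz; apply: K0; exists k.
Qed.

(** The equation [(d * c) *: m = m] says that [d * c - 1] kills [m], so the scalar criterion for
    simplicity only involves the annihilator of the generator. *)
Lemma simple_span1_ann (R : comNzRingType) (M N : lmodType R) (m : M) (n : N) :
  (forall r : R, r *: m = 0 <-> r *: n = 0) ->
  simple_submodule (span1 m) -> simple_submodule (span1 n).
Proof.
move=> annE /simple_span1P[m_nz inv_m]; apply/simple_span1P; split.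
  (* At the scalar 1, [annE] says that [m] and [n] vanish together. *)
  by apply: contra_neq m_nz; have := annE 1; rewrite !scale1r => -[].
move=> c cn_nz; have [|d dcm] := inv_m c.
  by apply: contra_neq cn_nz; have [] := annE c.
exists d; apply/eqP; rewrite -subr_eq0 -[X in _ - X]scale1r -scalerBl.
by apply/eqP/annE; rewrite scalerBl scale1r dcm subrr.
Qed.

Lemma simple_module_span1 (R : comNzRingType) (M : lmodType R) (m : M) :
  simple_module M -> m != 0 -> span1 m = setT.
Proof.
move=> [_ _ simpleM] m_nz.
have [m0|//] := simpleM _ (span1_submodule _ _ m) (@subsetT _ _).
have : span1 m m by exact: span1_id.
by rewrite m0 => /= m0'; rewrite m0' eqxx in m_nz.
Qed.

(** By commutativity, [r] moves past the coefficient of any multiple of [m] and kills [m] itself. *)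
Lemma span1_ann (R : comNzRingType) (M : lmodType R) (m : M) (r : R) :
  span1 m = setT -> r *: m = 0 -> ann M r.
Proof.
move=> mT rm0 x; have [s _ <-] : span1 m x by rewrite mT.
by rewrite scalerA mulrC -scalerA rm0 scaler0.
Qed.

(** If [j] lies in a proper ideal [J] above [ann M] but not in [ann M], then [j *: m] is nonzero and
    generates [m], say [d *: (j *: m) = m]. Hence [1 - d * j] is in [ann M], so in [J], and [J]
    contains 1. *)
Lemma simple_module_ann_maximal (R : comNzRingType) (M : lmodType R) (m : M) :
  simple_module M -> m != 0 -> maximal_ideal (ann M).
Proof.
move=> simpleM m_nz; have mT := simple_module_span1 _ _ _ simpleM m_nz.
split.
  apply/idealr_closedP; split=> [x||a r s r0 s0 x]; first exact: scale0r.
    by move=> /(_ m); rewrite scale1r => m0; rewrite m0 eqxx in m_nz.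
  by rewrite scalerDl -scalerA r0 s0 scaler0 addr0.
move=> J /idealr_closedP[J0 J1 JL] annJ; apply/seteqP; split=> // j Jj.
apply: (span1_ann _ _ _ _ mT); apply/eqP/negP => /negP jm_nz.
have [d _ djm] : span1 (j *: m) m by rewrite (simple_module_span1 _ _ _ simpleM).
apply: J1; rewrite -[1](subrKC (d * j)); apply: JL => //; apply: annJ.
by apply: (span1_ann _ _ _ _ mT); rewrite scalerBl scale1r -scalerA djm subrr.
Qed.

Lemma span1_pair (R : comNzRingType) (M1 M2 : lmodType R) (m1 : M1) (m2 : M2)
    (r : R) :
  span1 m1 = setT -> ann M1 r -> span1 (r *: m2) = setT ->
  span1 (m1, m2) = [set: (M1 * M2)%type].
Proof.
move=> m1T r0 rm2T; apply/seteqP; split=> // -[x1 x2] _.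
have [a _ ax1] : span1 m1 x1 by rewrite m1T.
have [b _ bx2] : span1 (r *: m2) (x2 - a *: m2) by rewrite rm2T.
(* The scalar [a] settles the first coordinate; the term [b * r] corrects the second without
   disturbing the first, since [r] kills [M1]. *)
exists (b * r + a) => //; rewrite scalerDl -scalerA.
by congr (_, _) => /=; rewrite ?r0 ?scaler0 ?add0r // bx2 subrK.
Qed.

Lemma cyclic_generator (R : comNzRingType) (M : lmodType R) :
  nonzero_module M -> cyclic_module M ->
  exists2 m : M, m != 0 & span1 m = setT.
Proof.
move=> M_nz [m mT]; exists m => //; apply/eqP => m0; apply: M_nz.
by rewrite -mT; apply/seteqP; split=> [_ [r _ <-]|_ ->];
  rewrite m0 ?scaler0 //; exact: span1_id.
Qed.

Lemma scale_pair_eq0 (R : comNzRingType) (M1 M2 : lmodType R) (r : R)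
    (m1 : M1) (m2 : M2) :
  r *: (m1, m2) = 0 <-> r *: m1 = 0 /\ r *: m2 = 0.
Proof. by split=> [[]|[r1 r2]] //; congr (_, _). Qed.

Theorem theorem10 (R : comNzRingType) (M1 M2 : lmodType R)
    (M1_nz : nonzero_module M1) (M1_cyc : cyclic_module M1)
    (M2_nz : nonzero_module M2) (M2_cyc : cyclic_module M2) :
  pseudo_simple (M1 * M2)%type <->
  [/\ simple_module M1, simple_module M2 &
      [/\ maximal_ideal (ann M1), maximal_ideal (ann M2), ann M1 <> ann M2 &
          forall (m1 : M1) (m2 : M2), m1 != 0 -> m2 != 0 ->
            span1 (m1, m2) = [set: (M1 * M2)%type]]
      \/
      (ann M1 = ann M2 /\ maximal_ideal (ann M1))].
Proof.
have [x1 x1_nz x1T] := cyclic_generator _ _ M1_nz M1_cyc.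
have [x2 x2_nz x2T] := cyclic_generator _ _ M2_nz M2_cyc.
have annl (m1 : M1) (r : R) : r *: (m1, 0 : M2) = 0 <-> r *: m1 = 0.
  by rewrite scale_pair_eq0 scaler0; split=> [[]|].
have annr (m2 : M2) (r : R) : r *: (0 : M1, m2) = 0 <-> r *: m2 = 0.
  by rewrite scale_pair_eq0 scaler0; split=> [[]|].
split=> [psM|[simple1 simple2 caseM]].
  have simple1 : simple_module M1.
    rewrite /simple_module -x1T; apply: simple_span1_ann (annl x1) _.
    apply: psM; first by apply: contra_neq x1_nz => -[].
    (* [(x1, 0)] is not a generator: its multiples have second coordinate 0, so they miss
       [(x1, x2)]. *)
    move=> xT; have [r _ []] : span1 (x1, 0 : M2) (x1, x2) by rewrite xT.
    by rewrite scaler0 => _ x20; rewrite -x20 eqxx in x2_nz.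
  have simple2 : simple_module M2.
    rewrite /simple_module -x2T; apply: simple_span1_ann (annr x2) _.
    apply: psM; first by apply: contra_neq x2_nz => -[].
    move=> xT; have [r _ []] : span1 (0 : M1, x2) (x1, x2) by rewrite xT.
    by rewrite scaler0 => x10 _; rewrite -x10 eqxx in x1_nz.
  have max1 := simple_module_ann_maximal _ _ _ simple1 x1_nz.
  have max2 := simple_module_ann_maximal _ _ _ simple2 x2_nz.
  split=> //; have [ann12|ann12] := pselect (ann M1 = ann M2); first by right.
  left; split=> // m1 m2 m1_nz m2_nz.
  have [r r1 r2] : exists2 r, ann M1 r & ~ ann M2 r.
    (* Without such an [r], the proper ideal [ann M2] would contain the maximal ideal [ann M1],
       hence equal it. *)
    apply: contrapT => no_r; apply: ann12; apply/esym/max1.2; first exact: max2.1.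
    by move=> r r1; apply: contrapT => r2; apply: no_r; exists r.
  apply: (span1_pair _ _ _ _ _ r) => //; first exact: simple_module_span1.
  (* If [r] killed the generator [m2], it would kill all of [M2]. *)
  apply: simple_module_span1 => //; apply/eqP => rm2; apply: r2.
  by apply: span1_ann rm2; exact: simple_module_span1.
have simple_span1 (M : lmodType R) (m : M) :
    simple_module M -> m != 0 -> simple_submodule (span1 m).
  by move=> simpleM m_nz; rewrite (simple_module_span1 _ _ m).
move=> [m1 m2] m_nz mT; have [m10|m1_nz] := eqVneq m1 0.
  have m2_nz : m2 != 0 by apply: contra_neq m_nz => ->; rewrite m10.
  rewrite m10; apply: (simple_span1_ann _ _ _ m2); last exact: simple_span1.
  by move=> r; rewrite annr.
have simple_m1 : simple_submodule (span1 m1) by exact: simple_span1.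
(* It remains to compare the annihilators of [m1] and [(m1, m2)]. With both coordinates nonzero,
   case (i) contradicts [mT]; in case (ii) a scalar killing [m1] lies in [ann M1 = ann M2], so it
   kills [m2] too. *)
apply: (simple_span1_ann _ _ _ m1) simple_m1 => r.
have [m20|m2_nz] := eqVneq m2 0; first by rewrite m20 annl.
case: caseM => [[_ _ _ genM]|[ann12 _]]; first by case: mT; exact: genM.
rewrite scale_pair_eq0; split=> [rm1|[]//]; split=> //.
have : ann M2 r by rewrite -ann12; apply: span1_ann rm1; exact: simple_module_span1.
exact.
Qed.
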